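(* For prime $N$, the number of active rows in the matrix $\mathcal{M}(N)$ is $\phi(N)-2$, where $\phi$ is Euler's totient function.
   Context: For integers $N,r\ge 1$ and a positive divisor $f$ of $Nr+1$, define $$\mathcal{X}(N,r,f)=\Big\{(a+b)-\Big(f+\tfrac{Nr+1}{f}\Big): ab=Nr\Big\},$$ where $a,b$ range over positive integers. The notation $[\mathcal{X}(N,r,f)]>0$ means that $f$ divides $Nr+1$ and $\mathcal{X}(N,r,f)$ consists only of positive integers; otherwise one writes $[\mathcal{X}(N,r,f)]\not>0$. The binary matrix $\mathcal{M}(N)=(m_{f,r})$, with rows indexed by $1\le f<N$ and columns indexed by $1\le r<N$, is defined by: $m_{f,r}=1$ if $\gcd(f,N)=1$ and $[\mathcal{X}(N,r,f)]>0$; $m_{f,r}=0$ if $\gcd(f,N)=1$ and $[\mathcal{X}(N,r,f)]\not>0$; and $m_{f,r}=0$ if $\gcd(f,N)>1$. A row of $\mathcal{M}(N)$ is called active if it contains a non-zero entry.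
   Formalization: For N = 2 the claim is false as written (there are 0 active rows but φ(2) − 2 = −1); the formal statement reads φ(N) − 2 as 0 in that case and is the stated claim for every odd prime. *)

(* Defs.v *)
From HB Require Import structures.
From mathcomp Require Import all_boot all_order all_algebra.

Set Implicit Arguments.
Unset Strict Implicit.
Unset Printing Implicit Defensive.

Import Order.TTheory GRing.Theory Num.Theory.

Local Open Scope ring_scope.

(* The pairs (a, b) of positive integers with ab = Nr are enumerated as
   (a, Nr / a) for a a divisor of Nr; see calXP for the set-builder form.
   The quotient (Nr + 1) / f is exact whenever f divides Nr + 1, which is the
   only case in which this is used. *)
Definition calX (N r f : nat) : seq int :=
  [seq (a + (N * r) %/ a)%N%:Z - (f + (N * r + 1) %/ f)%N%:Z
     | a <- divisors (N * r)].

Lemma calXP (N r f : nat) (x : int) : (0 < N)%N -> (0 < r)%N ->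
  reflect (exists a b : nat,
             [/\ (0 < a)%N, (0 < b)%N, (a * b = N * r)%N
               & x = (a + b)%N%:Z - (f + (N * r + 1) %/ f)%N%:Z])
          (x \in calX N r f).
Proof.
move=> N0 r0; have Nr0 : (0 < N * r)%N by rewrite muln_gt0 N0.
apply: (iffP mapP) => [[a] | [a [b [a0 b0 abE ->]]]].
  rewrite -dvdn_divisors // => adv ->; exists a, ((N * r) %/ a)%N.
  have abE : (a * (N * r %/ a) = N * r)%N by rewrite mulnC divnK.
  by move: Nr0; rewrite -{1}abE muln_gt0 => /andP[a0 b0]; split.
exists a; first by rewrite -dvdn_divisors // -abE dvdn_mulr.
by rewrite -abE mulKn.
Qed.

(* [X(N, r, f)] > 0 *)
Definition calX_pos (N r f : nat) : bool :=
  (f %| N * r + 1)%N && all (fun x : int => 0 < x) (calX N r f).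

(* Rows f and columns r range over 1, ..., N - 1, so the ordinals i, j < N.-1
   stand for f = i.+1 and r = j.+1. *)
Definition calM (N : nat) : 'M[nat]_(N.-1, N.-1) :=
  \matrix_(i < N.-1, j < N.-1)
    if gcdn i.+1 N == 1%N then
      if calX_pos N j.+1 i.+1 then 1%N else 0%N
    else 0%N.

Definition active_row (m n : nat) (A : 'M[nat]_(m, n)) (i : 'I_m) : bool :=
  [exists j, A i j != 0%N].

(* Main.v *)
Require Import Defs.
From mathcomp Require Import all_boot all_order all_algebra.
From mathcomp Require Import zify.

Set Implicit Arguments.
Unset Strict Implicit.
Unset Printing Implicit Defensive.

(** Write [fg = Nr + 1].  For [N] prime and [r <= N], any factorization
    [ab = Nr] has the shape [(Nk)(r/k)], and [Nk + r/k] is least at [k = 1], so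
    that positivity of [X(N, r, f)] amounts to [f + g < N + r].  Multiplying by
    [f], this becomes [1 < (N - f)(f - r)].  For [2 <= f <= N - 2] it holds with
    [r < f] the solution of [Nr = -1 mod f].  It fails for [f = 1] since
    [r >= 1], and for [f = N - 1] since [f] then divides [r + 1], while the
    inequality would give [r + 1 < f]. *)

Lemma prime_mul_addn_min (N r a b : nat) :
  prime N -> 0 < r <= N -> a * b = N * r -> N + r <= a + b.
Proof.
move=> N_prime /andP[r_gt0 rN].
wlog Na : a b / N %| a => [hw abE|].
  have : N %| a * b by rewrite abE dvdn_mulr.
  rewrite Euclid_dvdM // => /orP[Na|Nb]; first exact: hw.
  by rewrite [a + b]addnC; apply: hw => //; rewrite mulnC.
case/dvdnP: Na => k -> /eqP.
rewrite [k * N]mulnC -mulnA eqn_pmul2l ?prime_gt0 // => /eqP kbE.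
case: k kbE => [|k] kbE; first by lia.
(* Now a = N(k + 1) and r = (k + 1)b, so the two sides differ by k(N - b), and b <= r <= N. *)
nia.
Qed.

Lemma calX_pos_prime (N r f : nat) : prime N -> 0 < r <= N ->
  calX_pos N r f = (f %| N * r + 1) && (f + (N * r + 1) %/ f < N + r).
Proof.
move=> N_prime rN; have /andP[r_gt0 _] := rN.
have N_gt0 := prime_gt0 N_prime.
rewrite /calX_pos; congr (_ && _).
apply/allP/idP => [pos|lt x /calXP -/(_ N_gt0 r_gt0) [a [b [_ _ abE ->]]]].
  have/pos : ((N + r)%:Z - (f + (N * r + 1) %/ f)%:Z)%R \in calX N r f.
    by apply/calXP => //; exists N, r; split.
  by lia.
by have := prime_mul_addn_min N_prime rN abE; lia.
Qed.

Lemma exists_calX_posE (N f : nat) : prime N -> 0 < f < N ->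
  (exists2 r, 0 < r < N & calX_pos N r f) <-> 1 < f < N.-1.
Proof.
move=> N_prime /andP[f_gt0 fN]; split=> [[r /andP[r_gt0 rN]]|/andP[f_gt1 fN1]].
  rewrite calX_pos_prime ?r_gt0 ?(ltnW rN) // => /andP[/dvdnP[g gE]].
  rewrite gE mulnK // => lt.
  have f_gt1 : 1 < f by case: f f_gt0 fN gE lt => [|[|f]] //; nia.
  rewrite f_gt1 /= ltn_neqAle; apply/andP; split; last by lia.
  apply/eqP => fE.
  have : f %| r + 1.
    (* Substitute N = f + 1 into fg = Nr + 1. *)
    have -> : r + 1 = (g - r) * f by nia.
    exact: dvdn_mull.
  by move/dvdn_leq => -/(_ ltac:(lia)); nia.
have fN_coprime : gcdn f N = 1.
  by apply/eqP; rewrite -/(coprime f N) coprime_sym prime_coprime // gtnNdvd.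
(* Bezout gives gf = rN + 1 with the bound r < f, so g is the cofactor of f. *)
case: (egcdnP N f_gt0) => g r; rewrite fN_coprime muln1 => gE rf.
have r_gt0 : 0 < r.
  by case: r gE rf => // /eqP; rewrite mul0n muln_eq1 => /andP[_ /eqP f1]; lia.
have rN : 0 < r < N by rewrite r_gt0 (ltn_trans rf).
exists r => //; rewrite calX_pos_prime ?r_gt0 ?(ltnW (ltn_trans rf fN)) //.
rewrite mulnC -gE dvdn_mull // mulnK //=.
suff : (f + g) * f < (N + r) * f by rewrite ltn_pmul2r.
(* The factors are at least 2 and 1, since f < N - 1 and r < f. *)
have : 1 < (N - f) * (f - r) by nia.
nia.
Qed.

Lemma active_row_calM (N : nat) (i : 'I_N.-1) : prime N ->
  active_row (calM N) i = (1 < i.+1 < N.-1).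
Proof.
move=> N_prime; have iN : i.+1 < N by have := ltn_ord i; lia.
have iN_coprime : gcdn i.+1 N == 1.
  by rewrite -/(coprime i.+1 N) coprime_sym prime_coprime // gtnNdvd.
apply/existsP/idP => [[j]|].
  rewrite mxE iN_coprime; case: ifP => // pos _.
  apply/(exists_calX_posE N_prime) => //; exists j.+1 => //.
  by have := ltn_ord j; lia.
case/(exists_calX_posE N_prime) => // -[//|r] rN pos.
have rN1 : r < N.-1 by lia.
by exists (Ordinal rN1); rewrite mxE iN_coprime pos.
Qed.

Theorem lemma5p2 (N : nat) (N_prime : prime N) :
  #|[set f : 'I_N.-1 | active_row (calM N) f]| = (totient N - 2)%N.
Proof.
rewrite totient_prime // -sum1dep_card.
under eq_bigl => i do rewrite active_row_calM //.
rewrite -(big_mkord (fun i => 1 < i.+1 < N.-1) (fun=> 1)).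
(* For N = 2 the only row, f = 1, is inactive, and the truncated 1 - 2 is 0. *)
case: (N.-1) => [|[|n]]; first by rewrite big_geq.
  by rewrite big_mkcond big_nat1.
(* The end terms f = 1 and f = N - 1 vanish; the n terms between them are 1. *)
rewrite big_ltn_cond //= big_mkcond big_nat_recr //= ltnn addn0.
rewrite (eq_big_nat _ _ (F2 := fun=> 1)) => [|i /andP[i_gt0 lt_in]].
  by rewrite sum_nat_const_nat muln1 subn1 subn2.
by rewrite !ltnS i_gt0 -ltnS lt_in.
Qed.
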